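(* Let $\psi:\mathbb{S}_{++}^d\to\mathbb{R}$ be differentiable, isotonic and concave on $\mathbb{S}_{++}^d$, and let $\phi(M):=-\psi(M^{-1})$ for $M\succ 0$. Let $f$ be the associated objective function, and consider the iterates of the multiplicative algorithm with power parameter $\lambda$ applied to $\sup_{w\in\Delta_n} f(w)$. Assume that for some $k\ge 0$, the iterate $w^k$ satisfies $w^k\in\Delta_n^+$ and $\nabla_i f(w^k)>0$ for all $i\in\mathcal{I}_k$. If $w^{k+1}\neq w^k$, or equivalently, if $$\exists\, i,j\in\mathcal{I}_k\ \text{ such that }\ \nabla_i f(w^k)\neq\nabla_j f(w^k),\qquad ( * )$$ then for any $\lambda\in(0,1)$ we have $f(w^{k+1})>f(w^k)$. In addition, if $\mathcal{I}_k=[n]$, then $( * )$ holds if and only if $w^k\notin\mathcal{W}^*$, where $\mathcal{W}^*:=\arg\max_{w\in\Delta_n} f(w)$ denotes the set of optimal solutions of $\sup_{w\in\Delta_n} f(w)$.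
   Context: $\mathbb{S}^d$, $\mathbb{S}_+^d$, $\mathbb{S}_{++}^d$ denote the real symmetric $d\times d$ matrices, the positive semidefinite ones, and the positive definite ones; $A\succeq B$ (resp. $A\succ B$) means $A-B\in\mathbb{S}_+^d$ (resp. $A-B\in\mathbb{S}_{++}^d$). The inner product on $\mathbb{S}^d$ is $\langle A,B\rangle=\mathrm{tr}(AB)$, and gradients are taken with respect to it. A function $\psi:\mathbb{S}_{++}^d\to\mathbb{R}$ is isotonic if $0\prec A\preceq B$ implies $\psi(A)\le\psi(B)$. Data: $[n]=\{1,\dots,n\}$; $A_1,\dots,A_n\in\mathbb{S}_+^d$ with $A_i\neq 0$ for all $i\in[n]$ and $\sum_{i=1}^n A_i\succ 0$. For $w\in\mathbb{R}^n$, $M(w):=\sum_{i=1}^n w_iA_i$. $\Delta_n:=\{w\in\mathbb{R}^n: w\ge 0,\ \sum_i w_i=1\}$, $\mathrm{ri}\,\Delta_n:=\{w>0:\sum_i w_i=1\}$, $\Delta_n^+:=\{w\in\Delta_n: M(w)\succ 0\}$. Objective: given a differentiable $\phi:\mathbb{S}_{++}^d\to\mathbb{R}$, $f(w):=\phi(M(w))$ if $M(w)\succ 0$ and $f(w):=-\infty$ otherwise. At any $w$ with $M(w)\succ0$, $f$ is differentiable with partial derivatives $\nabla_i f(w)=\langle\nabla\phi(M(w)),A_i\rangle$. Multiplicative algorithm with power parameter $\lambda\in(0,1]$: start from $w^0\in\mathrm{ri}\,\Delta_n$; at iteration $k\ge 0$, set $\bar w^k_i:=w^k_i\,(\nabla_i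 f(w^k))^\lambda$ for $i\in[n]$ and $w^{k+1}:=\bar w^k/\sum_{i=1}^n\bar w^k_i$. $\mathcal{I}_k:=\{i\in[n]:w^k_i>0\}$ is the support of $w^k$.
   Formalization: In the last claim, the direction ''w^k not in W* implies ( * )'' is proved under the added assumption that φ is concave on the positive definite matrices; without it that direction is false (e.g. f(w)=w_1^2+w_2^2 at w=(1/2,1/2)). *)

(* Defs.v *)
From HB Require Import structures.
From mathcomp Require Import all_boot all_order all_algebra.
From mathcomp Require Import all_classical all_reals all_analysis.

Set Implicit Arguments.
Unset Strict Implicit.
Unset Printing Implicit Defensive.

Import Order.TTheory GRing.Theory Num.Theory.
Import numFieldNormedType.Exports.

Local Open Scope classical_set_scope.
Local Open Scope ring_scope.

Section SymmetricMatrices.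
Context {R : realType} {d : nat}.
Implicit Types (A B G H M : 'M[R]_d) (g : 'M[R]_d -> R).

Definition symmx : set 'M[R]_d := [set A | A^T = A].

Definition psd : set 'M[R]_d :=
  [set A | symmx A /\ forall x : 'cV[R]_d, 0 <= (x^T *m A *m x) 0 0].

Definition spd : set 'M[R]_d :=
  [set A | symmx A /\ forall x : 'cV[R]_d, x != 0 -> 0 < (x^T *m A *m x) 0 0].

(* Fréchet gradient on the space of symmetric matrices with inner product
   tr(AB): increments H are restricted to symmetric matrices, and nothing is
   said about g off the symmetric matrices. The norm is the sup norm of the
   entries, which is equivalent to the one induced by the inner product. *)
Definition is_gradient g M G : Prop :=
  symmx G /\
  (g (M + H) - g M - \tr (G *m H)) / `|H|
    @[H --> within symmx (0 : 'M[R]_d)^'] --> (0 : R).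

Definition differentiable_spd g : Prop :=
  forall M, spd M -> exists G, is_gradient g M G.

Definition isotonic_spd g : Prop :=
  forall A B, spd A -> psd (B - A) -> g A <= g B.

Definition concave_spd g : Prop :=
  forall A B (t : R), spd A -> spd B -> 0 <= t <= 1 ->
  t * g A + (1 - t) * g B <= g (t *: A + (1 - t) *: B).

End SymmetricMatrices.

Section Design.
Context {R : realType} {d n : nat}.
Variables (A : 'I_n -> 'M[R]_d) (phi : 'M[R]_d -> R).
Implicit Types w : 'rV[R]_n.

Definition moment w : 'M[R]_d := \sum_i w 0 i *: A i.

Definition simplex : set 'rV[R]_n :=
  [set w | (forall i, 0 <= w 0 i) /\ \sum_i w 0 i = 1].

Definition ri_simplex : set 'rV[R]_n :=
  [set w | (forall i, 0 < w 0 i) /\ \sum_i w 0 i = 1].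

Definition simplex_plus : set 'rV[R]_n :=
  [set w | simplex w /\ spd (moment w)].

Definition objective w : \bar R :=
  if `[< spd (moment w) >] then (phi (moment w))%:E else -oo%E.

(* Only meaningful where moment w is positive definite: the objective is finite
   in a neighbourhood of such a w, and fine only serves to make it real-valued. *)
Definition partial_objective (i : 'I_n) w : R :=
  'D_(delta_mx 0 i) (fine \o objective) w.

Definition supp w : {set 'I_n} := [set i | 0 < w 0 i].

Definition optimal_set : set 'rV[R]_n :=
  [set w | simplex w /\ forall v, simplex v -> (objective v <= objective w)%E].

(* Partial derivatives of the objective are nonnegative where moment w is
   positive definite, so powR is the usual power there. If the normalizing sum
   vanishes, the step returns 0, where the objective is -oo for d > 0. *)
Definition mult_step (lambda : R) w : 'rV[R]_n :=
  let wbar := \row_i (w 0 i * (partial_objective i w) `^ lambda) in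
  (\sum_i wbar 0 i)^-1 *: wbar.

Definition mult_iter (lambda : R) (w0 : 'rV[R]_n) (k : nat) : 'rV[R]_n :=
  iter k (mult_step lambda) w0.

Definition nonconstant_gradient_on_support w : Prop :=
  exists i j, [/\ i \in supp w, j \in supp w &
    partial_objective i w != partial_objective j w].

End Design.

(* Main.v *)
Require Import Defs.
From mathcomp Require Import all_boot all_order all_algebra.
From mathcomp Require Import all_classical all_reals all_analysis.
From mathcomp Require Import ring lra.
Import Order.TTheory GRing.Theory Num.Theory.
Import numFieldNormedType.Exports.
Local Open Scope classical_set_scope.
Local Open Scope ring_scope.

(** Write M(w) for the moment matrix of w, M = M(w), N = M^-1, let G be the
gradient of psi at N, p_i the i-th partial derivative of the objective at w and
w' the next iterate.

The ascent property is a minorization argument with two layers. Weighted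
Cauchy-Schwarz for matrices ([psd_moment_inv]) says that, for v with the support
of w,
    M(v)^-1 <= N M(u) N    in the Loewner order, where u_i = w_i^2 / v_i.
Isotonicity of psi, and then concavity in the form of the gradient inequality
at N, turn this into
    psi (M(v)^-1) <= psi N + tr (G (N M(u) N - N)).
The chain rule gives p_i = tr (N G N A_i), so the right-hand side is
psi N + sum_i (w_i^2 / v_i) p_i - sum_i w_i p_i ([objective_minorant]).
For v = w', whose weights are w_i p_i^lambda / Z, the first sum is
    (sum_i w_i p_i^lambda) (sum_i w_i p_i^(1 - lambda)),
and Chebyshev's sum inequality bounds it by sum_i w_i p_i, strictly as soon as p
takes two values on the support, because for 0 < lambda < 1 the powers lambda
and 1 - lambda are both strictly increasing ([step_bound_lt]). All the
strictness thus comes from Chebyshev's inequality.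

The step multiplies the weight w_i by p_i^lambda / Z, where Z is the w-average
of the p_j^lambda; all these factors are 1 on the support exactly when p is
constant there ([mult_step_neqP]).

Optimality is a first-order condition. At an optimal w the derivative along
e_i - e_j cannot be positive for i, j in the support, and exchanging i and j
makes p_i = p_j ([optimal_slope_eq]). Conversely, if w has full support and p is
constant then the derivative along v - w vanishes for every v in the simplex,
which is enough for optimality when phi is concave ([slope_const_optimal]).

The chain rule needs only directional derivatives ([gradient_invmx_dir]): the
resolvent identity (M + h S)^-1 - N = - h (M + h S)^-1 S N exhibits the
increment of the inverse as h times a convergent matrix, by continuity of
inversion ([cvg_invmx]). The directions that occur are supported in the support
of w; they preserve the nonnegativity and the support of the weights for small
h, hence positive definiteness of the moment matrix ([spd_moment_supp]). *)

(** * Chebyshev's sum inequality and powers *)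

(** The double sum of p_i p_j (a_i - a_j) (b_i - b_j) is twice the gap between
the two sides, and its term at (i0, j0) makes it positive. *)
Lemma chebyshev_sum_lt (R : realFieldType) (n : nat) (p a b : 'I_n -> R)
    (i0 j0 : 'I_n) :
  (forall i, 0 <= p i) -> \sum_i p i = 1 ->
  (forall i j, 0 < p i -> 0 < p j -> 0 <= (a i - a j) * (b i - b j)) ->
  0 < p i0 -> 0 < p j0 -> 0 < (a i0 - a j0) * (b i0 - b j0) ->
  (\sum_i p i * a i) * (\sum_i p i * b i) < \sum_i p i * (a i * b i).
Proof.
move=> p0 p1 mono pi0 pj0 lt0.
pose D := \sum_i \sum_j p i * p j * ((a i - a j) * (b i - b j)).
have term_ge0 i j : 0 <= p i * p j * ((a i - a j) * (b i - b j)).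
  have [-> |pi_neq0] := eqVneq (p i) 0; first by rewrite !mul0r.
  have [-> |pj_neq0] := eqVneq (p j) 0; first by rewrite mulr0 !mul0r.
  apply: mulr_ge0; first exact: mulr_ge0.
  by apply: mono; rewrite lt0r ?pi_neq0 ?pj_neq0 p0.
have D_gt0 : 0 < D.
  rewrite /D (bigD1 i0) //= (bigD1 j0) //=.
  rewrite -addrA ltr_wpDr //; last by apply: mulr_gt0 => //; exact: mulr_gt0.
  by rewrite addr_ge0 ?sumr_ge0 // => i _; rewrite sumr_ge0.
suff DE : D = 2 * (\sum_i p i * (a i * b i) -
    (\sum_i p i * a i) * (\sum_i p i * b i)).
  by move: D_gt0; rewrite DE pmulr_rgt0 ?subr_gt0.
have expand i : \sum_j p i * p j * ((a i - a j) * (b i - b j)) =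
    p i * (a i * b i) - p i * a i * (\sum_j p j * b j)
    - p i * b i * (\sum_j p j * a j) + p i * (\sum_j p j * (a j * b j)).
  rewrite -[X in _ = X - _ - _ + _]mulr1 -p1 !mulr_sumr -!sumrB -big_split /=.
  by apply: eq_bigr => j _; ring.
rewrite /D (eq_bigr _ (fun i _ => expand i)) big_split /= !sumrB -!mulr_suml p1.
by ring.
Qed.

Lemma powR_cosorted_gt0 (R : realType) (x y r s : R) :
  0 <= x -> 0 <= y -> x != y -> 0 < r -> 0 < s ->
  0 < (x `^ r - y `^ r) * (x `^ s - y `^ s).
Proof.
move=> x0 y0 xy r0 s0.
wlog lt_xy : x y x0 y0 xy / x < y => [hw|].
  have [lt_xy|lt_yx|eq_xy] := ltgtP x y; first exact: hw.
    by rewrite -mulrNN !opprB hw // eq_sym.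
  by rewrite eq_xy eqxx in xy.
rewrite -mulrNN !opprB.
by apply: mulr_gt0; rewrite subr_gt0 gt0_ltr_powR.
Qed.

(** * Quadratic forms and the Loewner order *)

Section QuadraticForms.
Set Implicit Arguments.
Unset Strict Implicit.
Context {R : realType} {d : nat}.
Implicit Types (A B M : 'M[R]_d) (x y z : 'cV[R]_d).

Definition bform A x y : R := (x^T *m A *m y) 0 0.

Lemma bformD A B x y : bform (A + B) x y = bform A x y + bform B x y.
Proof. by rewrite /bform mulmxDr mulmxDl mxE. Qed.

Lemma bformB A B x y : bform (A - B) x y = bform A x y - bform B x y.
Proof. by rewrite /bform mulmxBr mulmxBl !mxE. Qed.

Lemma bform_sum (I : finType) (c : I -> R) (A : I -> 'M[R]_d) x y :
  bform (\sum_i c i *: A i) x y = \sum_i c i * bform (A i) x y.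
Proof.
rewrite /bform mulmx_sumr mulmx_suml summxE; apply: eq_bigr => i _.
by rewrite -scalemxAr -scalemxAl mxE.
Qed.

Lemma bformC A x y : symmx A -> bform A x y = bform A y x.
Proof.
move=> symA; rewrite /bform -[in RHS](trmxK (y^T *m A *m x)) [in RHS]mxE.
by rewrite !trmx_mul trmxK symA mulmxA.
Qed.

Lemma bform_congr A B x y : symmx B ->
  bform (B *m A *m B) x y = bform A (B *m x) (B *m y).
Proof. by move=> symB; rewrite /bform trmx_mul symB !mulmxA. Qed.

Lemma bform_subZ A x y (c : R) : symmx A ->
  bform A (x - c *: y) (x - c *: y) =
  bform A x x - 2 * c * bform A x y + c ^+ 2 * bform A y y.
Proof.
move=> symA.
have bB u v s t : bform A (u - s *: v) t = bform A u t - s * bform A v t.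
  by rewrite /bform linearB linearZ /= !mulmxBl -!scalemxAl !mxE.
rewrite bB !(bformC _ (x - c *: y)) // !bB (bformC y x) //; ring.
Qed.

Lemma spdD_psd A B : spd A -> psd B -> spd (A + B).
Proof.
move=> [sA pA] [sB pB]; split; first by rewrite /symmx /= linearD /= sA sB.
move=> x x0; rewrite -/(bform _ _ _) bformD.
by rewrite ltr_wpDr ?pB // pA.
Qed.

Lemma spd_unitmx M : spd M -> M \in unitmx.
Proof.
move=> [_ posM]; rewrite unitmxE unitfE; apply/det0P => -[v v0 vM].
have := posM v^T; rewrite trmx_eq0 trmxK vM mul0mx mxE ltxx.
by move/(_ v0).
Qed.

Lemma symmx_inv M : symmx M -> symmx (invmx M).
Proof. by move=> symM; rewrite /symmx /= trmx_inv symM. Qed.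

Lemma spd_inv M : spd M -> spd (invmx M).
Proof.
move=> spdM; have unitM := spd_unitmx spdM; have [symM posM] := spdM.
have symN := symmx_inv symM; split=> // x x0.
rewrite -/(bform _ _ _) -[invmx M]mulmx1 -(mulmxV unitM) mulmxA.
rewrite bform_congr //; apply: posM.
by apply: contra_neq x0 => /(congr1 (mulmx M)); rewrite mulKVmx // mulmx0.
Qed.

Lemma symmx_sum (I : finType) (c : I -> R) (A : I -> 'M[R]_d) :
  (forall i, symmx (A i)) -> symmx (\sum_i c i *: A i).
Proof.
move=> symA; rewrite /symmx /= linear_sum; apply: eq_bigr => i _.
by rewrite linearZ /= symA.
Qed.

End QuadraticForms.

(** * Moment matrices *)

Section Moments.
Set Implicit Arguments.
Unset Strict Implicit.
Context {R : realType} {d n : nat} {A : 'I_n -> 'M[R]_d}.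
Hypothesis psdA : forall i, psd (A i).
Implicit Types (u v w : 'rV[R]_n).

Lemma psd_moment v : (forall i, 0 <= v 0 i) -> psd (moment A v).
Proof.
move=> v0; split; first by apply: symmx_sum => i; case: (psdA i).
move=> x; rewrite -/(bform _ _ _) bform_sum sumr_ge0 // => i _.
by rewrite mulr_ge0 // (psdA i).2.
Qed.

(** A sum of nonnegative terms vanishes only if each term does: the quadratic form
of [moment A w] is zero at x iff the form of every A_i with w_i > 0 is, which
depends on w through its support only. Small perturbations that do not shrink
the support therefore stay positive definite, without any appeal to openness of
the positive definite cone. *)
Lemma spd_moment_supp w v : (forall i, 0 <= w 0 i) -> (forall i, 0 <= v 0 i) ->
  (forall i, 0 < w 0 i -> 0 < v 0 i) -> spd (moment A w) -> spd (moment A v).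
Proof.
move=> w0 v0 wv [_ posw]; have [symv posv] := psd_moment v0.
split=> // x x0; rewrite lt0r posv andbT; apply/eqP.
rewrite -/(bform _ _ _) bform_sum => /psumr_eq0P-/(_ _) vq0.
have /= := posw x x0; rewrite -/(bform _ _ _) bform_sum big1 ?ltxx // => i _.
have [-> |wi_neq0] := eqVneq (w 0 i) 0; first by rewrite mul0r.
have vi_gt0 : 0 < v 0 i by apply: wv; rewrite lt0r wi_neq0 w0.
have /eqP := vq0 (fun i _ => mulr_ge0 (v0 i) ((psdA i).2 x)) i isT.
by rewrite mulf_eq0 gt_eqF //= => /eqP ->; rewrite mulr0.
Qed.

(** Matrix Cauchy-Schwarz (or Jensen for the inverse). With y = M(w)^-1 x and
z = M(v)^-1 x, the form at x of the difference is
sum_i v_i q_i (z - (w_i / v_i) y), where q_i is the form of A_i: both the cross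
term sum_i w_i (z, A_i y) and sum_i v_i q_i (z) equal (x, M(v)^-1 x). *)
Lemma psd_moment_inv w v : (forall i, 0 <= v 0 i) ->
  (forall i, v 0 i = 0 -> w 0 i = 0) ->
  spd (moment A w) -> spd (moment A v) ->
  psd (invmx (moment A w) *m moment A (\row_i (w 0 i ^+ 2 / v 0 i))
         *m invmx (moment A w) - invmx (moment A v)).
Proof.
move=> v0 vw spdw spdv; set N := invmx (moment A w); set V := invmx _.
set U := moment A _.
have symN : symmx N := (spd_inv spdw).1.
have symV : symmx V := (spd_inv spdv).1.
have symA i : symmx (A i) := (psdA i).1.
have symU : symmx U by exact: symmx_sum.
split; first by rewrite /symmx /= linearB /= !trmx_mul symN symU symV mulmxA.
move=> x; rewrite -/(bform _ _ _); set y := N *m x; set z := V *m x.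
have Vzz : bform V x x = bform (moment A v) z z.
  by rewrite -bform_congr // -mulmxA mulmxV ?mulmx1 //; exact: spd_unitmx.
have Vzy : bform V x x = bform (moment A w) z y.
  rewrite /bform -(mulmxA z^T) mulKVmx; last exact: spd_unitmx.
  by rewrite /z trmx_mul symV.
have -> : bform (N *m U *m N - V) x x =
    bform U y y - 2 * bform (moment A w) z y + bform (moment A v) z z.
  by rewrite bformB bform_congr // -Vzz -Vzy -/y; ring.
rewrite !bform_sum mulr_sumr -sumrB -big_split sumr_ge0 //= => i _; rewrite mxE.
(* Complete the square in z; a null v_i forces w_i = 0 and the term is 0. *)
have [v_eq0 |v_neq0] := eqVneq (v 0 i) 0.
  by rewrite v_eq0 (vw i v_eq0) expr0n !mul0r mulr0 subrr addr0.
suff -> : w 0 i ^+ 2 / v 0 i * bform (A i) y y -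
    2 * (w 0 i * bform (A i) z y) + v 0 i * bform (A i) z z =
    v 0 i * bform (A i) (z - (w 0 i / v 0 i) *: y) (z - (w 0 i / v 0 i) *: y).
  by rewrite mulr_ge0 // (psdA i).2.
by rewrite bform_subZ //; field.
Qed.

End Moments.

(** * Continuity of matrix operations *)

Section MatrixLimits.
Set Implicit Arguments.
Unset Strict Implicit.
Context {R : realType} {T : Type} {F : set_system T} {FF : Filter F}.

Lemma cvg_mxP (m n : nat) (X : T -> 'M[R]_(m, n)) (L : 'M[R]_(m, n)) :
  X t @[t --> F] --> L <-> forall i j, X t i j @[t --> F] --> L i j.
Proof.
split=> [XL i j | XL].
  exact: (cvg_comp _ _ XL (@coord_continuous _ _ _ i j L)).
apply/cvgrPdist_le => /= e e0; near=> t.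
rewrite /Num.Def.normr/= mx_normrE (bigmax_le _ (ltW e0))//= => -[i j] _.
rewrite !mxE/=; move: i j; near: t.
apply: filter_forall => i; apply: filter_forall => j.
exact: ((cvgrPdist_le _ _).1 (XL i j)).
Unshelve. all: by end_near. Qed.

Lemma cvg_mulmx (m n p : nat) (X : T -> 'M[R]_(m, n)) (Y : T -> 'M[R]_(n, p))
    (L : 'M[R]_(m, n)) (K : 'M[R]_(n, p)) :
  X t @[t --> F] --> L -> Y t @[t --> F] --> K ->
  X t *m Y t @[t --> F] --> L *m K.
Proof.
move=> /cvg_mxP XL /cvg_mxP YK; apply/cvg_mxP => i j.
rewrite mxE; under eq_cvg do rewrite mxE.
by apply: cvg_big => [|k _]; [exact: add_continuous|exact: cvgM].
Qed.

Lemma cvg_mxtrace (n : nat) (X : T -> 'M[R]_n) (L : 'M[R]_n) :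
  X t @[t --> F] --> L -> \tr (X t) @[t --> F] --> \tr L.
Proof.
move=> /cvg_mxP XL.
by apply: cvg_big => [|k _]; [exact: add_continuous|exact: XL].
Qed.

Lemma cvg_det (n : nat) (X : T -> 'M[R]_n) (L : 'M[R]_n) :
  X t @[t --> F] --> L -> \det (X t) @[t --> F] --> \det L.
Proof.
move=> /cvg_mxP XL.
apply: cvg_big => [|s _]; first exact: add_continuous.
apply: cvgM; first exact: cvg_cst.
by apply: cvg_big => [|k _]; [exact: mul_continuous|exact: XL].
Qed.

(** Near an invertible limit the inverse is the adjugate over the determinant, a
rational function of the entries. *)
Lemma cvg_invmx (n : nat) (X : T -> 'M[R]_n) (L : 'M[R]_n) : L \in unitmx ->
  X t @[t --> F] --> L -> invmx (X t) @[t --> F] --> invmx L.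
Proof.
rewrite unitmxE unitfE => detL XL.
have detX := cvg_det XL.
apply: (@cvg_trans _ ((\det (X t))^-1 *: \adj (X t) @[t --> F])).
  apply: near_eq_cvg; near=> t; rewrite /invmx unitmxE unitfE.
  suff -> : \det (X t) != 0 by [].
  by near: t; exact: cvgr_neq0 detX detL.
rewrite /invmx unitmxE unitfE detL; apply/cvg_mxP => i j.
rewrite !mxE; under eq_cvg do rewrite !mxE.
apply: cvgM; first exact: cvgV.
apply: cvgM; first exact: cvg_cst.
apply: cvg_det; apply/cvg_mxP => a b.
rewrite !mxE; under eq_cvg do rewrite !mxE.
by move/cvg_mxP : XL; exact.
Unshelve. all: by end_near. Qed.

End MatrixLimits.

(** * Gradients along curves *)

Section Gradient.
Set Implicit Arguments.
Unset Strict Implicit.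
Context {R : realType} {d : nat}.
Implicit Types (g psi : 'M[R]_d -> R) (G H M N S : 'M[R]_d).

(** Multiplying out the denominator includes the increment H = 0, so that the
bound can be used along curves that may pass through M. *)
Lemma is_gradient_littleo g M G : is_gradient g M G ->
  forall e : R, 0 < e -> \forall H \near (0 : 'M[R]_d), symmx H ->
    `|g (M + H) - g M - \tr (G *m H)| <= e * `|H|.
Proof.
move=> [_ /cvgr0Pnorm_le] gradG e e0.
have := gradG e e0; rewrite !near_withinE; apply: filterS => H le_e symH.
have [->|H0] := eqVneq H 0.
  by rewrite addr0 subrr mulmx0 mxtrace0 subrr !normr0 mulr0.
have := le_e H0 symH.
rewrite normrM normrV ?unitfE ?normr_eq0 // normr_id ler_pdivrMr //.
by rewrite normr_gt0.
Qed.

(** Chain rule along a curve M + h K(h) with K convergent; allowing K to vary is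
what makes it applicable to the inverse of a moving matrix. *)
Lemma gradient_dir_cvg g M G (K : R -> 'M[R]_d) (L : 'M[R]_d) :
  is_gradient g M G ->
  (\forall h \near 0^', symmx (K h)) -> K h @[h --> 0^'] --> L ->
  h^-1 * (g (M + h *: K h) - g M) @[h --> 0^'] --> \tr (G *m L).
Proof.
move=> gradG symK KL.
pose r H := g (M + H) - g M - \tr (G *m H).
have hK0 : h *: K h @[h --> 0^'] --> (0 : 'M[R]_d).
  rewrite -(scale0r L); apply: cvgZ => //.
  exact: nbhs_dnbhs.
have trK : \tr (G *m K h) @[h --> 0^'] --> \tr (G *m L).
  by apply: cvg_mxtrace; apply: cvg_mulmx => //; exact: cvg_cst.
suff r0 : h^-1 * r (h *: K h) @[h --> 0^'] --> (0 : R).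
  rewrite -(add0r (\tr (G *m L))); apply: cvg_trans (cvgD r0 trK).
  apply: near_eq_cvg; near=> h.
  have h0 : h != 0 by near: h; exact: nbhs_dnbhs_neq.
  rewrite fctE /= /r -scalemxAr mxtraceZ.
  by rewrite [in LHS]mulrBr mulKf // subrK.
apply/cvgr0Pnorm_le => e e0.
have B0 : 0 < `|L| + 1 by rewrite ltr_wpDl.
have e'0 : 0 < e / (`|L| + 1) by rewrite divr_gt0.
near=> h.
have h0 : h != 0 by near: h; exact: nbhs_dnbhs_neq.
have rh : `|r (h *: K h)| <= e / (`|L| + 1) * `|h *: K h|.
  have : symmx (h *: K h).
    by rewrite /symmx /= linearZ /=; congr (_ *: _); near: h.
  by near: h; exact: hK0 _ (is_gradient_littleo gradG e'0).
have Kh : `|K h| <= `|L| + 1.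
  by near: h; apply: (cvgr_norm_le L KL); rewrite ltrDl.
rewrite normrM normrV ?unitfE // ler_pdivrMl ?normr_gt0 //.
apply: (le_trans rh); rewrite normrZ.
have -> : `|h| * e = e / (`|L| + 1) * (`|h| * (`|L| + 1)).
  by field; rewrite gt_eqF.
by rewrite (ler_wpM2l (ltW e'0)) // ler_wpM2l.
Unshelve. all: by end_near. Qed.

(** The derivative of inversion at M in the direction S is - M^-1 S M^-1; the
formula follows by cyclicity of the trace. *)
Lemma gradient_invmx_dir psi M G S :
  M \in unitmx -> symmx M -> symmx S -> is_gradient psi (invmx M) G ->
  h^-1 * (psi (invmx (M + h *: S)) - psi (invmx M)) @[h --> 0^'] -->
  - \tr (invmx M *m G *m invmx M *m S).
Proof.
move=> unitM symM symS gradG.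
set N : 'M[R]_d := invmx M.
pose X (h : R) : 'M[R]_d := M + h *: S.
pose K (h : R) : 'M[R]_d := - (invmx (X h) *m S *m N).
have XM : X h @[h --> (0 : R)^'] --> M.
  suff : X h @[h --> (0 : R)^'] --> M + 0 *: S by rewrite scale0r addr0.
  by apply: cvgD; [exact: cvg_cst|apply: cvgZr_tmp; exact: nbhs_dnbhs].
have unitX : \forall h \near (0 : R)^', X h \in unitmx.
  have detM : \det M != 0 by rewrite -unitfE -unitmxE.
  near=> h; rewrite unitmxE unitfE; near: h.
  exact: cvgr_neq0 (cvg_det XM) detM.
(* The resolvent identity, read off from h S = (M + h S) - M. *)
have KE : \forall h \near (0 : R)^', h *: K h = invmx (X h) - N.
  near=> h; have uX : X h \in unitmx by near: h.
  rewrite /K scalerN scalemxAl scalemxAr.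
  rewrite [h *: S](_ : _ = X h - M); last by rewrite /X addrC addKr.
  by rewrite mulmxBr mulVmx // mulmxBl mul1mx -mulmxA mulmxV // mulmx1 opprB.
have symX h : symmx (X h) by rewrite /symmx /= linearD linearZ /= symM symS.
have -> : - \tr (N *m G *m N *m S) = \tr (G *m (- (N *m S *m N))).
  by rewrite mulmxN raddfN -!mulmxA mxtrace_mulC !mulmxA.
apply: cvg_trans (gradient_dir_cvg gradG _ (_ : K h @[h --> 0^'] --> _)).
- apply: near_eq_cvg; near=> h; congr (_ * (psi _ - _)).
  by rewrite (near KE h) // addrC subrK.
- near=> h.
  have h0 : h != 0 by near: h; exact: nbhs_dnbhs_neq.
  have -> : K h = h^-1 *: (invmx (X h) - N).
    by rewrite -(near KE h) // scalerA mulVf // scale1r.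
  by rewrite /symmx /= linearZ linearB /= !symmx_inv.
- apply: cvgN; apply: cvg_mulmx; last exact: cvg_cst.
  by apply: cvg_mulmx; [exact: cvg_invmx|exact: cvg_cst].
Unshelve. all: by end_near. Qed.

(** Concavity bounds every difference quotient from M towards B below by
g B - g M, and the quotients tend to the directional derivative. *)
Lemma concave_gradient_le g M G B : concave_spd g -> is_gradient g M G ->
  spd M -> spd B -> g B <= g M + \tr (G *m (B - M)).
Proof.
move=> concg gradG spdM spdB.
have symD : symmx (B - M).
  by rewrite /symmx /= linearB /= (spdM.1 : _ = _) (spdB.1 : _ = _).
have D : h^-1 * (g (M + h *: (B - M)) - g M) @[h --> 0^'+] -->
    \tr (G *m (B - M)).
  apply: cvg_dnbhs_at_right.
  by apply: (gradient_dir_cvg gradG); [near=> h|exact: cvg_cst].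
rewrite -lerBlDl; apply: (cvgr_to_ge D); near=> h.
have h0 : 0 < h by [].
have h1 : h <= 1 by near: h; exact: nbhs_right_ltW.
rewrite ler_pdivlMl //.
have := concg B M h spdB spdM; rewrite (ltW h0) h1 => /(_ isT).
have -> : h *: B + (1 - h) *: M = M + h *: (B - M).
  rewrite scalerBl scale1r scalerBr addrCA addrC -!addrA.
  by congr (_ + _); rewrite addrC.
by lra.
Unshelve. all: by end_near. Qed.

End Gradient.

(** * The objective function *)

Section Objective.
Set Implicit Arguments.
Unset Strict Implicit.
Context {R : realType} {d n : nat} (A : 'I_n -> 'M[R]_d).
Context (psi phi : 'M[R]_d -> R).
Hypothesis psdA : forall i, psd (A i).
Hypothesis phiE : forall M, spd M -> phi M = - psi (invmx M).
Implicit Types (u v w : 'rV[R]_n) (G : 'M[R]_d).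

(** When G is the gradient of psi at the inverse of M = M(w), the gradient of
phi at M is M^-1 G M^-1, and this is its inner product with A_i: the closed form
of the i-th partial derivative of the objective. *)
Definition slope w G i : R :=
  \tr (invmx (moment A w) *m G *m invmx (moment A w) *m A i).

Lemma sum_slope w G u :
  \sum_i u 0 i * slope w G i =
  \tr (invmx (moment A w) *m G *m invmx (moment A w) *m moment A u).
Proof.
rewrite mulmx_sumr raddf_sum; apply: eq_bigr => i _.
by rewrite -scalemxAr /= mxtraceZ.
Qed.

Lemma objectiveE w : spd (moment A w) ->
  objective A phi w = (phi (moment A w))%:E.
Proof. by move=> spdw; rewrite /objective asboolT. Qed.

Lemma moment_line w u (h : R) :
  moment A (w + h *: u) = moment A w + h *: moment A u.
Proof.
rewrite /moment scaler_sumr -big_split; apply: eq_bigr => i _ /=.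
by rewrite !mxE scalerDl scalerA.
Qed.

Lemma near_supp_line w u : (forall i, 0 <= w 0 i) ->
  (forall i, w 0 i = 0 -> u 0 i = 0) ->
  \forall h \near (0 : R), forall i,
    0 <= (w + h *: u) 0 i /\ (0 < w 0 i -> 0 < (w + h *: u) 0 i).
Proof.
move=> w0 uw.
pose P i (h : R) :=
  0 <= (w + h *: u) 0 i /\ (0 < w 0 i -> 0 < (w + h *: u) 0 i).
suff near1 i : \forall h \near (0 : R), P i h.
  exact: (@filter_forall _ _ P _ _ near1).
rewrite /P.
have [wi_eq0|wi_neq0] := eqVneq (w 0 i) 0.
  by near=> h; rewrite !mxE uw // wi_eq0 mulr0 addr0 ltxx.
have wi_gt0 : 0 < w 0 i by rewrite lt0r wi_neq0 w0.
have lim : w 0 i + h * u 0 i @[h --> (0 : R)] --> w 0 i.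
  suff : w 0 i + h * u 0 i @[h --> (0 : R)] --> w 0 i + 0 * u 0 i.
    by rewrite mul0r addr0.
  apply: cvgD; first exact: cvg_cst.
  by apply: cvgM; [exact: cvg_id|exact: cvg_cst].
near=> h; suff pos : 0 < (w + h *: u) 0 i by split=> //; exact: ltW.
by rewrite !mxE; near: h; exact: (cvgr_gt _ lim).
Unshelve. all: by end_near. Qed.

Section AtPoint.
Context (w : 'rV[R]_n) (G : 'M[R]_d).
Hypothesis w0 : forall i, 0 <= w 0 i.
Hypothesis spdw : spd (moment A w).
Hypothesis gradG : is_gradient psi (invmx (moment A w)) G.

(** As u only moves weights in the support of w, w + h u has nonnegative weights
with at least the support of w for small h of either sign, and the objective
stays finite along the line. *)
Lemma objective_dir_cvg u : (forall i, w 0 i = 0 -> u 0 i = 0) ->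
  h^-1 * (fine (objective A phi (w + h *: u)) - fine (objective A phi w))
    @[h --> 0^'] --> \sum_i u 0 i * slope w G i.
Proof.
move=> uw; have symU : symmx (moment A u).
  by apply: symmx_sum => i; exact: (psdA i).1.
have lim := gradient_invmx_dir (spd_unitmx spdw) spdw.1 symU gradG.
rewrite sum_slope -(opprK (\tr _)); apply: cvg_trans (cvgN lim).
apply: near_eq_cvg; near=> h.
have spdh : spd (moment A (w + h *: u)).
  have supph i : 0 <= (w + h *: u) 0 i /\ (0 < w 0 i -> 0 < (w + h *: u) 0 i).
    by move: i; near: h; apply: nbhs_dnbhs; exact: near_supp_line.
  by apply: spd_moment_supp spdw => // i; case: (supph i).
rewrite fctE -mulrN !objectiveE //= !phiE // moment_line opprK.
by congr (_ * _); rewrite opprB addrC.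
Unshelve. all: by end_near. Qed.

Lemma partial_objectiveE i : 0 < w 0 i ->
  partial_objective A phi i w = slope w G i.
Proof.
move=> wi_gt0; apply: cvg_lim => //.
have uw j : w 0 j = 0 -> (delta_mx 0 i : 'rV[R]_n) 0 j = 0.
  move=> wj0; rewrite mxE eqxx; case: eqP => // ji.
  by move: wi_gt0; rewrite -ji wj0 ltxx.
have := objective_dir_cvg uw.
rewrite (bigD1 i) //= big1 => [|j /negbTE ji]; last first.
  by rewrite mxE ji andbF mul0r.
rewrite mxE !eqxx mul1r addr0 => lim; apply: (cvg_trans _ lim).
by apply: near_eq_cvg; near=> h; rewrite /= [w + _]addrC.
Unshelve. all: by end_near. Qed.

(** A minorant of the objective that is tight at v = w. Isotonicity replaces
M(v)^-1 by its Cauchy-Schwarz upper bound, a congruence of a moment matrix, so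
that linearizing psi by concavity leaves a combination of the slopes. *)
Lemma objective_minorant v : isotonic_spd psi -> concave_spd psi ->
  (forall i, 0 <= v 0 i) -> (forall i, 0 < w 0 i -> 0 < v 0 i) ->
  phi (moment A w) + \sum_i w 0 i * slope w G i
    - \sum_i w 0 i ^+ 2 / v 0 i * slope w G i <= phi (moment A v).
Proof.
move=> isopsi concpsi v0 wv.
have spdv : spd (moment A v) by exact: spd_moment_supp spdw.
have vw i : v 0 i = 0 -> w 0 i = 0.
  move=> vi0; apply/eqP/negPn/negP => wi_neq0.
  by have := wv i; rewrite lt0r wi_neq0 w0 vi0 ltxx => /(_ isT).
have psdBV := psd_moment_inv psdA v0 vw spdw spdv.
set u := \row_i _ in psdBV; set N := invmx (moment A w) in psdBV.
set V := invmx _ in psdBV; set B := N *m _ *m N in psdBV.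
have spdN : spd N by exact: spd_inv.
have spdV : spd V by exact: spd_inv.
have spdB : spd B by rewrite -[B](subrK V) addrC; exact: spdD_psd.
have VB := isopsi V B spdV psdBV.
have BN := concave_gradient_le concpsi gradG spdN spdB.
have trB : \tr (G *m B) = \sum_i w 0 i ^+ 2 / v 0 i * slope w G i.
  rewrite (eq_bigr (fun i => u 0 i * slope w G i)); last first.
    by move=> i _; rewrite mxE.
  by rewrite sum_slope -/N /B !mulmxA [LHS]mxtrace_mulC !mulmxA.
have trN : \tr (G *m N) = \sum_i w 0 i * slope w G i.
  rewrite sum_slope -(mulmxA _ N) mulVmx; last exact: spd_unitmx.
  by rewrite mulmx1 mxtrace_mulC.
rewrite !phiE // -/N -/V -trB -trN.
by move: BN; rewrite mulmxBr raddfB /=; lra.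
Qed.

(** For small h > 0 the point w + h u is still in the simplex, so the difference
quotients of the objective from w towards it are not positive. *)
Lemma optimal_dir_le0 u : optimal_set A phi w ->
  (forall i, w 0 i = 0 -> u 0 i = 0) -> \sum_i u 0 i = 0 ->
  \sum_i u 0 i * slope w G i <= 0.
Proof.
move=> [[_ w1] opt] uw u0.
apply: (cvgr_to_le (cvg_dnbhs_at_right (objective_dir_cvg uw))).
near=> h; have h0 : 0 < h by [].
have supph i : 0 <= (w + h *: u) 0 i /\ (0 < w 0 i -> 0 < (w + h *: u) 0 i).
  by move: i; near: h; apply: cvg_within; exact: near_supp_line.
have spdh : spd (moment A (w + h *: u)).
  by apply: spd_moment_supp spdw => // i; case: (supph i).
rewrite pmulr_rle0 ?invr_gt0 // subr_le0.
have := opt (w + h *: u); rewrite !objectiveE // lee_fin; apply.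
split=> [i|]; first by case: (supph i).
under eq_bigr do rewrite mxE [X in _ + X]mxE.
by rewrite big_split -mulr_sumr /= w1 u0 mulr0 addr0.
Unshelve. all: by end_near. Qed.

Lemma optimal_slope_eq i j : optimal_set A phi w ->
  0 < w 0 i -> 0 < w 0 j -> slope w G i = slope w G j.
Proof.
move=> opt.
wlog suff : i j / 0 < w 0 i -> 0 < w 0 j -> slope w G i <= slope w G j.
  by move=> le wi wj; apply/eqP; rewrite eq_le !le.
move=> wi wj; pose u : 'rV[R]_n := delta_mx 0 i - delta_mx 0 j.
have sumu (c : 'I_n -> R) : \sum_k u 0 k * c k = c i - c j.
  under eq_bigr do rewrite !mxE eqxx /= mulrBl !mulr_natl !mulrb.
  by rewrite sumrB -!big_mkcond !big_pred1_eq.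
rewrite -subr_le0 -sumu; apply: optimal_dir_le0 => // [k wk0|].
  rewrite !mxE eqxx /=; case: eqP => [ki|_].
    by move: wi; rewrite -ki wk0 ltxx.
  by case: eqP => [kj|_]; rewrite ?subr0 //; move: wj; rewrite -kj wk0 ltxx.
by have := sumu (fun=> 1); under eq_bigr do rewrite mulr1; rewrite subrr.
Qed.

(** Two points of the simplex have the same total weight, so a constant gradient
has zero derivative along v - w; concavity of phi makes this first-order
condition sufficient. *)
Lemma slope_const_optimal (c : R) : concave_spd phi ->
  (forall i, 0 < w 0 i) -> \sum_i w 0 i = 1 ->
  (forall i, slope w G i = c) -> optimal_set A phi w.
Proof.
move=> concphi wpos w1 slopec; split=> [//|v [v0 v1]].
have [spdv|Nspdv] := pselect (spd (moment A v)); last first.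
  by rewrite /objective (asboolF Nspdv) leNye.
rewrite !objectiveE // lee_fin.
have uw i : w 0 i = 0 -> (v - w) 0 i = 0.
  by move=> wi0; have := wpos i; rewrite wi0 ltxx.
have lim := cvg_dnbhs_at_right (objective_dir_cvg uw).
have sum0 : \sum_i (v - w) 0 i * slope w G i = 0.
  under eq_bigr do rewrite slopec !mxE.
  by rewrite -mulr_suml sumrB v1 w1 subrr mul0r.
rewrite sum0 in lim.
rewrite -subr_le0; apply: (cvgr_to_ge lim); near=> h.
have h0 : 0 < h by [].
have h1 : h <= 1 by near: h; exact: nbhs_right_ltW.
have lineE : moment A (w + h *: (v - w)) =
    h *: moment A v + (1 - h) *: moment A w.
  rewrite /moment !scaler_sumr -big_split; apply: eq_bigr => i _ /=.
  by rewrite !mxE !scalerA -scalerDl; congr (_ *: _); ring.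
have spdh : spd (moment A (w + h *: (v - w))).
  have supph i : 0 <= (w + h *: (v - w)) 0 i /\
      (0 < w 0 i -> 0 < (w + h *: (v - w)) 0 i).
    by move: i; near: h; apply: cvg_within; exact: near_supp_line.
  by apply: spd_moment_supp spdw => // i; case: (supph i).
rewrite !objectiveE //= ler_pdivlMl // lineE.
have := concphi _ _ h spdv spdw; rewrite (ltW h0) h1 => /(_ isT); lra.
Unshelve. all: by end_near. Qed.

End AtPoint.
End Objective.

(** * The multiplicative step *)

Section MultiplicativeStep.
Set Implicit Arguments.
Unset Strict Implicit.
Context {R : realType} {d n : nat} (A : 'I_n -> 'M[R]_d) (phi : 'M[R]_d -> R).
Context (lambda : R) (w : 'rV[R]_n).
Hypothesis w0 : forall i, 0 <= w 0 i.
Hypothesis w1 : \sum_i w 0 i = 1.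
Local Notation p := (fun i => partial_objective A phi i w).
Hypothesis p_gt0 : forall i, 0 < w 0 i -> 0 < p i.

Let pos_ge0 i : 0 < w 0 i -> p i \is Num.nneg.
Proof. by move=> wi; rewrite nnegrE ltW // p_gt0. Qed.

Definition step_normalizer : R := \sum_i w 0 i * p i `^ lambda.
Local Notation Z := step_normalizer.

Lemma mult_stepE i :
  mult_step A phi lambda w 0 i = w 0 i * (p i `^ lambda / Z).
Proof.
rewrite /mult_step !mxE /Z mulrC -mulrA; congr (_ * (_ / _)).
by apply: eq_bigr => j _; rewrite mxE.
Qed.

Lemma step_normalizer_gt0 : 0 < Z.
Proof.
have term_ge0 i : 0 <= w 0 i * p i `^ lambda by rewrite mulr_ge0 ?powR_ge0.
rewrite lt0r sumr_ge0 ?andbT // psumr_eq0 //; apply/allPn => /=.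
have [i wi_neq0] : exists i, w 0 i != 0.
  apply: contrapT => wz; move/eqP: w1.
  rewrite big1 ?[0 == 1]eq_sym ?oner_eq0 // => i _.
  by apply/eqP/negPn/negP => wi; apply: wz; exists i.
have wi_gt0 : 0 < w 0 i by rewrite lt0r wi_neq0 w0.
exists i; first by rewrite mem_index_enum.
by rewrite mulf_neq0 // gt_eqF // powR_gt0 // p_gt0.
Qed.

Lemma mult_step_ge0 i : 0 <= mult_step A phi lambda w 0 i.
Proof.
by rewrite mult_stepE mulr_ge0 ?divr_ge0 ?powR_ge0 // ltW ?step_normalizer_gt0.
Qed.

Lemma mult_step_gt0 i : 0 < w 0 i -> 0 < mult_step A phi lambda w 0 i.
Proof.
move=> wi; rewrite mult_stepE mulr_gt0 // divr_gt0 ?step_normalizer_gt0 //.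
by rewrite powR_gt0 // p_gt0.
Qed.

(** Fixed points: every factor p_i^lambda / Z on the support must be 1, that is,
p_i^lambda is constant there, and so is p_i because lambda > 0. *)
Lemma mult_step_neqP : 0 < lambda ->
  mult_step A phi lambda w != w <-> nonconstant_gradient_on_support A phi w.
Proof.
move=> lambda_gt0; split=> [neq|[i [j]]]; last first.
  rewrite !inE => -[wi wj]; apply: contra_neq => eqw.
  have factor1 k : 0 < w 0 k -> p k `^ lambda = Z.
    move=> wk; have := mult_stepE k; rewrite eqw -[LHS]mulr1.
    move/(mulfI (lt0r_neq0 wk))/esym/divr1_eq; exact.
  apply: (powR_injective lambda_gt0 (pos_ge0 wi) (pos_ge0 wj)).
  by rewrite /= !factor1.
apply: contrapT => const; move/negP: neq; apply; apply/eqP/rowP => i.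
rewrite mult_stepE; have [->|wi_neq0] := eqVneq (w 0 i) 0.
  by rewrite mul0r.
have wi : 0 < w 0 i by rewrite lt0r wi_neq0 w0.
suff -> : Z = p i `^ lambda.
  by rewrite divff ?mulr1 // gt_eqF // powR_gt0 // p_gt0.
rewrite -[RHS]mul1r -w1 mulr_suml; apply: eq_bigr => j _.
have [->|wj_neq0] := eqVneq (w 0 j) 0.
  by rewrite [LHS]mul0r [RHS]mul0r.
suff -> : partial_objective A phi j w = partial_objective A phi i w by [].
apply/eqP/negPn/negP => neq; apply: const.
by exists j, i; split; rewrite ?inE // lt0r wj_neq0 w0.
Qed.

(** The left-hand side is the product of the w-averages of p^lambda and of
p^(1 - lambda), where Z is the first; their pointwise product is p. *)
Lemma step_bound_lt : 0 < lambda < 1 ->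
  nonconstant_gradient_on_support A phi w ->
  \sum_i w 0 i ^+ 2 / mult_step A phi lambda w 0 i * p i < \sum_i w 0 i * p i.
Proof.
move=> /andP[l0 l1] [i0 [j0]]; rewrite !inE => -[wi0 wj0 neq].
have l1' : 0 < 1 - lambda by rewrite subr_gt0.
have powE i : 0 < w 0 i -> p i `^ lambda * p i `^ (1 - lambda) = p i.
  move=> wi; rewrite -powRD; last first.
    by rewrite (gt_eqF (p_gt0 wi)) implybT.
  by rewrite subrKC powRr1 // ltW ?p_gt0.
have -> : \sum_i w 0 i ^+ 2 / mult_step A phi lambda w 0 i * p i =
    Z * \sum_i w 0 i * p i `^ (1 - lambda).
  rewrite mulr_sumr; apply: eq_bigr => i _; rewrite mult_stepE.
  have [->|wi_neq0] := eqVneq (w 0 i) 0.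
    by rewrite expr0n !mul0r mulr0.
  have wi : 0 < w 0 i by rewrite lt0r wi_neq0 w0.
  have pl : 0 < p i `^ lambda by rewrite powR_gt0 // p_gt0.
  rewrite -[X in _ * X = _]powE //; field.
  by rewrite wi_neq0 !gt_eqF ?step_normalizer_gt0.
have -> : \sum_i w 0 i * p i =
    \sum_i w 0 i * (p i `^ lambda * p i `^ (1 - lambda)).
  apply: eq_bigr => i _; have [->|wi_neq0] := eqVneq (w 0 i) 0.
    by rewrite !mul0r.
  by rewrite powE // lt0r wi_neq0 w0.
apply: (chebyshev_sum_lt _ _ _ _ _ i0 j0) => // [i j wi wj|].
  have [->|neqij] := eqVneq (p i) (p j); first by rewrite !subrr mul0r.
  by rewrite ltW // powR_cosorted_gt0 // ltW ?p_gt0.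
by rewrite powR_cosorted_gt0 // ltW ?p_gt0.
Qed.

End MultiplicativeStep.

(** * Ascent and optimality *)

Theorem proposition1 (R : realType) (d n : nat) (A : 'I_n -> 'M[R]_d)
    (psi phi : 'M[R]_d -> R) (lambda : R) (w0 : 'rV[R]_n) (k : nat) :
  (forall i, psd (A i)) ->
  (forall i, A i != 0) ->
  spd (\sum_i A i) ->
  differentiable_spd psi ->
  isotonic_spd psi ->
  concave_spd psi ->
  (forall M, spd M -> phi M = - psi (invmx M)) ->
  0 < lambda <= 1 ->
  ri_simplex w0 ->
  let w := mult_iter A phi lambda w0 in
  let f := objective A phi in
  simplex_plus A (w k) ->
  (forall i, i \in supp (w k) -> 0 < partial_objective A phi i (w k)) ->
  [/\ w k.+1 != w k <-> nonconstant_gradient_on_support A phi (w k),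
      lambda < 1 -> w k.+1 != w k -> (f (w k) < f (w k.+1))%E &
      supp (w k) = [set: 'I_n]%SET ->
        (nonconstant_gradient_on_support A phi (w k) ->
           ~ optimal_set A phi (w k)) /\
        (concave_spd phi -> ~ optimal_set A phi (w k) ->
           nonconstant_gradient_on_support A phi (w k))].
Proof.
move=> psdA _ _ diffpsi isopsi concpsi phiE /andP[l0 _] _ w f.
have -> : w k.+1 = mult_step A phi lambda (w k) by [].
move: (w k) => {w}x.
move=> [[x0 x1] spdx] px_supp.
have px i : 0 < x 0 i -> 0 < partial_objective A phi i x.
  by move=> xi; apply: px_supp; rewrite inE.
have [G gradG] := diffpsi _ (spd_inv spdx).
have slopeE i : 0 < x 0 i -> partial_objective A phi i x = slope A x G i.
  by move=> xi; exact: (partial_objectiveE psdA phiE x0 spdx gradG xi).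
have neqP := mult_step_neqP x0 x1 px l0.
split=> [//|l1 /neqP noncst|full].
- have spdv : spd (moment A (mult_step A phi lambda x)).
    apply: (spd_moment_supp psdA x0 _ _ spdx); first exact: mult_step_ge0.
    exact: mult_step_gt0.
  rewrite /f !objectiveE // lte_fin.
  have minor := objective_minorant psdA phiE x0 spdx gradG isopsi concpsi
    (mult_step_ge0 lambda x0 x1 px) (mult_step_gt0 lambda x0 x1 px).
  apply: lt_le_trans minor.
  (* The closed form of the partial derivatives is established on the support of
     x, and the weights in both sums vanish off it. *)
  have slope_sum (c : 'I_n -> R) : (forall i, x 0 i = 0 -> c i = 0) ->
      \sum_i c i * slope A x G i = \sum_i c i * partial_objective A phi i x.
    move=> c0; apply: eq_bigr => i _.
    have [xi0|xi_neq0] := eqVneq (x 0 i) 0; first by rewrite c0 ?mul0r.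
    by rewrite slopeE // lt0r xi_neq0 x0.
  rewrite -addrA ltrDl subr_gt0 !slope_sum // => [|i ->].
    by apply: step_bound_lt; rewrite ?l0.
  by rewrite expr0n mul0r.
- have xpos i : 0 < x 0 i by have := finset.in_setT i; rewrite -full inE.
  split=> [[i [j [_ _ /eqP neq]]] opt|concphi nopt].
    apply: neq; rewrite !slopeE //.
    exact: (optimal_slope_eq psdA phiE x0 spdx gradG opt).
  apply: contrapT => cst; apply: nopt.
  have [i0 _|noi] := pickP 'I_n; last first.
    by move: x1; rewrite big_pred0 // => /eqP; rewrite eq_sym oner_eq0.
  apply: (slope_const_optimal psdA phiE x0 spdx gradG
    (c := slope A x G i0)) => // i.
  rewrite -(slopeE i (xpos i)) -(slopeE i0 (xpos i0)).
  apply/eqP/negPn/negP => neq; apply: cst.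
  by exists i, i0; split; rewrite ?inE.
Qed.
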